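(* Let $X$ be a Hausdorff space, let $\mathcal{I},\mathcal{K}$ be ideals on $S$ such that $\mathcal{I}\cup\mathcal{K}$ is an ideal, and let $f: S \to X$ be $\mathcal{I}^{\mathcal{K}}$-convergent to $x$. Then there exists an ideal $\mathcal{J}$ on $S$ such that $x \in X$ is an $\mathcal{I}^{\mathcal{K}}$-limit of the function $f$ if and only if $x$ is also a $\mathcal{J}$-limit of $f$.
   Context: $S$ is a set. An ideal on $S$ is a family of subsets of $S$ closed under finite unions and under taking subsets; throughout, ideals are assumed proper ($S$ is not a member) and to contain all finite subsets of $S$. For an ideal $\mathcal{I}$, $\mathcal{I}^*=\{A\subseteq S : S\setminus A\in\mathcal{I}\}$. For ideals $\mathcal{I},\mathcal{K}$ on $S$, $\mathcal{I}\cup\mathcal{K}$ denotes the family $\{I\cup K : I\in\mathcal{I}, K\in\mathcal{K}\}$; saying that it is an ideal means it is a proper ideal, equivalently $S\neq I\cup K$ for all $I\in\mathcal{I}$, $K\in\mathcal{K}$. For an ideal $\mathcal{J}$ on $S$, $f:S\to X$ is $\mathcal{J}$-convergent to $x$ ($x$ is a $\mathcal{J}$-limit of $f$) if $\{s\in S: f(s)\notin U\}\in\mathcal{J}$ for every neighborhood $U$ of $x$. $f$ is $\mathcal{I}^{\mathcal{K}}$-convergent to $x$ ($x$ is an $\mathcal{I}^{\mathcal{K}}$-limit of $f$) if there is $M\in\mathcal{I}^*$ such that the function $g:S\to X$ with $g(s)=f(s)$ for $s\in M$ and $g(s)=x$ for $s\notin M$ is $\mathcal{K}$-convergent to $x$.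 *)

(* Defs.v *)
From HB Require Import structures.
From mathcomp Require Import all_boot all_order all_algebra.
From mathcomp Require Import all_classical all_reals all_analysis.

Set Implicit Arguments.
Unset Strict Implicit.
Unset Printing Implicit Defensive.

Local Open Scope classical_set_scope.

(* Ideals are proper and contain all finite sets; the empty set, i.e. the empty
   union, is covered by [ideal_finite]. *)
Record ideal (S : Type) (I : set (set S)) : Prop := Ideal {
  ideal_setU : forall A B, I A -> I B -> I (A `|` B);
  ideal_sub : forall A B, A `<=` B -> I B -> I A;
  ideal_proper : ~ I setT;
  ideal_finite : forall A, finite_set A -> I A }.

Definition dual_filter (S : Type) (I : set (set S)) : set (set S) :=
  [set A | I (~` A)].

(* The family written I \cup K in the literature: unions of members of the two
   families, not the union of the families themselves. *)
Definition ideal_join (S : Type) (I K : set (set S)) : set (set S) :=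
  [set A `|` B | A in I & B in K].

Definition ideal_limit (S : Type) (X : topologicalType) (J : set (set S))
    (f : S -> X) (x : X) : Prop :=
  forall U : set X, nbhs x U -> J [set s | ~ U (f s)].

(* [patch (fun=> x) M f] equals [f] on [M] and [x] outside [M]. *)
Definition IK_limit (S : Type) (X : topologicalType) (I K : set (set S))
    (f : S -> X) (x : X) : Prop :=
  exists2 M : set S, dual_filter I M & ideal_limit K (patch (fun=> x) M f) x.

(* Main.v *)
(* In a Hausdorff space limits along the ideal generated by [I] and [K] are
   unique, and every [I^K]-limit is such a limit. Hence this ideal works: its
   only limit of [f] is the given [I^K]-limit [x]. *)
Require Import Defs.
From HB Require Import structures.
From mathcomp Require Import all_boot all_order all_algebra.
From mathcomp Require Import all_classical all_reals all_analysis.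

Local Open Scope classical_set_scope.

(** If neighborhoods [U] of [x] and [V] of [y] were disjoint, the sets where [f] misses [U] and
    where it misses [V] would cover [S], so [J] would not be proper. *)
Lemma ideal_limit_unique (S : Type) (X : topologicalType) (J : set (set S))
    (f : S -> X) (x y : X) :
  hausdorff_space X -> ideal J -> ideal_limit J f x -> ideal_limit J f y ->
  x = y.
Proof.
move=> hX hJ fx fy; apply: hX => U V xU yV; apply: contrapT => UV0.
apply: (ideal_proper hJ).
apply: (ideal_sub hJ _ (ideal_setU hJ (fx U xU) (fy V yV))) => s _ /=.
apply/not_andP => UVs; apply: UV0.
by exists (f s).
Qed.

Lemma IK_limit_ideal_join (S : Type) (X : topologicalType) (I K : set (set S))
    (f : S -> X) (y : X) :
  ideal (ideal_join I K) -> IK_limit I K f y -> ideal_limit (ideal_join I K) f y.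
Proof.
move=> hIK [M IM fy] U yU.
apply: (ideal_sub hIK (B := ~` M `|` [set s | ~ U (patch (fun=> y) M f s)])).
  move=> s /= Ufs; have [Ms|Ms] := pselect (M s); last by left.
  by right; rewrite patchT ?inE.
by exists (~` M); [exact: IM | exists [set s | ~ U (patch (fun=> y) M f s)]; [exact: fy|]].
Qed.

Theorem theorem2p8 (S : Type) (X : topologicalType) (hX : hausdorff_space X)
  (I K : set (set S)) (hI : ideal I) (hK : ideal K)
  (hIK : ideal (ideal_join I K)) (f : S -> X) (x : X) (hf : IK_limit I K f x) :
  exists J : set (set S), ideal J /\
    forall y : X, IK_limit I K f y <-> ideal_limit J f y.
Proof.
exists (ideal_join I K); split => // y; split.
  exact: IK_limit_ideal_join.
move=> fy; have fx := IK_limit_ideal_join _ _ _ _ _ _ hIK hf.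
(* Uniqueness replaces [y] by [x], and [hf] closes the goal. *)
by rewrite -(ideal_limit_unique _ _ _ _ _ _ hX hIK fx fy).
Qed.
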